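(* Let $a\ge 2$ be an integer and $\sigma$ a permutation in $\mathfrak{S}_n$. Assume $\sigma$ has no cycles of length smaller than $a$, except fixed points (whose number is denoted by $b$). The number of ways to write $\sigma$ as the product of an $n$-cycle and an $(n-a)$-cycle is $$\bigl(1+(-1)^{a}\varepsilon(\sigma)\bigr)\,\frac{(n-a-1)!\,(n-b)!}{a!\,(n-a-b+1)!}.$$
   Context: $\varepsilon(\sigma)\in\{1,-1\}$ is the signature of $\sigma$. For $0\le a<n$, an $(n-a)$-cycle in $\mathfrak{S}_n$ is a permutation of cycle type $(n-a,1^a)$. The number of ways to write $\sigma$ as such a product is the number of pairs $(\alpha,\beta)$ with $\sigma=\alpha\beta$, $\alpha$ an $n$-cycle and $\beta$ an $(n-a)$-cycle in $\mathfrak{S}_n$.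
   Formalization: The case n-a=1 with σ an n-cycle is excluded: there the number of ways is 1 while the formula gives n (e.g. n=3, a=2, σ=(1 2 3): 1 versus 3). For σ the identity, 1/(n-a-b+1)! with negative argument is read as 0. *)

(* Defs.v *)
From mathcomp Require Import all_boot all_order all_fingroup all_algebra.

Set Implicit Arguments.
Unset Strict Implicit.
Unset Printing Implicit Defensive.

Import GRing.Theory.

Local Open Scope ring_scope.

(* Fixed points contribute parts equal to 1, so this is a partition of n. *)
Definition cycle_type (n : nat) (s : 'S_n) : seq nat :=
  sort geq [seq #|(C : {set 'I_n})| | C <- enum (porbits s)].

(* Only meaningful for 0 < k <= n.  The identity is the only "1-cycle", so for
   n - a = 1 an n-cycle has a single factorization, whereas the closed formula
   gives n (it counts the n choices of a distinguished fixed point of the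
   identity).  That one case has to be excluded from the formula. *)
Definition is_kcycle (n k : nat) (s : 'S_n) : bool :=
  cycle_type s == k :: nseq (n - k) 1%N.

Definition num_fixed (n : nat) (s : 'S_n) : nat := #|[set x | s x == x]|.

(* (s * t)%g applies s first.  Since s * t = t * (s ^ t) and s ^ t has the
   cycle type of s, the number of factorizations does not depend on the order
   in which permutations are composed. *)
Definition num_factorizations (n a : nat) (s : 'S_n) : nat :=
  #|[set p : 'S_n * 'S_n |
      [&& is_kcycle n p.1, is_kcycle (n - a) p.2 & s == (p.1 * p.2)%g]]|.

Definition signature (n : nat) (s : 'S_n) : rat := (-1) ^+ odd_perm s.

(* 1 / z!, with the usual convention 1 / z! = 0 for z < 0. *)
Definition recip_fact (z : int) : rat :=
  if z is Posz m then (m`!%:R)^-1 else 0.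

(* Main.v *)
(* Write sigma = b * c, with c an n-cycle and b an (n-a)-cycle (the order of the
   factors is immaterial up to conjugation), and mark one fixed point y of b; let
   S be the set of the a - 1 other ones. On S, c agrees with sigma, so S contains
   no cycle of sigma, and erasing the points of S from the cycle notations of
   sigma and c reduces to the case a = 1: an odd permutation of N points has
   2 (N-2)! factorizations into an (N-1)-cycle and an N-cycle, by induction on N.
   Hence a times the number sought is 2 (n-a-1)! times the number of
   (a-1)-sets S containing no cycle of sigma, provided sigma has the parity of a.
   Under the hypothesis on cycle lengths these are the (a-1)-sets of non-fixed
   points. *)
Require Import Defs.
From mathcomp Require Import all_boot all_order all_fingroup all_algebra.
From mathcomp Require Import zify ring.

Set Implicit Arguments.
Unset Strict Implicit.
Unset Printing Implicit Defensive.
Local Open Scope group_scope.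

(** * Cycles supported on a set, and the erasure of a point *)

Section CycleOn.
Variable T : finType.
Implicit Types (A B C S : {set T}) (s t a b : {perm T}) (x y z : T).

Definition stable s B := [forall u in B, s u \in B].

Lemma stableP s B : reflect {in B, forall u, s u \in B} (stable s B).
Proof. exact: forall_inP. Qed.

(** Minimality among nonempty stable sets says that [A] is a single orbit, and it can be followed
    through the erasure of a point without powers of [s]. A singleton carries the identity as its
    only cycle. *)
Definition cycle_on A s :=
  [&& A != set0, perm_on A s &
    [forall B : {set T}, [&& B != set0, B \subset A & stable s B] ==> (B == A)]].

Lemma cycle_onP A s :
  reflect [/\ A != set0, perm_on A s &
    forall B : {set T}, B != set0 -> B \subset A -> stable s B -> B = A]
  (cycle_on A s).
Proof.
apply: (iffP and3P) => -[A0 As minA]; split=> //.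
  by move=> B B0 BA Bs; apply/eqP; move/forallP/(_ B): minA; rewrite B0 BA Bs.
by apply/forallP=> B; apply/implyP=> /and3P[B0 BA Bs]; apply/eqP/minA.
Qed.

(* Erases x from the cycle notation of s. *)
Definition del x s := s * tperm x (s x).

Lemma delx x s : del x s x = x.
Proof. by rewrite permM tpermR. Qed.

Lemma delE x s u : u != x -> del x s u = if s u == x then s x else s u.
Proof.
move=> ux; rewrite permM; case: eqP => [->|/eqP nx]; first by rewrite tpermL.
by rewrite tpermD // eq_sym // (inj_eq perm_inj).
Qed.

Lemma odd_del x s : s x != x -> odd_perm (del x s) = ~~ odd_perm s.
Proof. by move=> sx; rewrite odd_permM odd_tperm eq_sym sx addbT. Qed.

Lemma perm_on_del A x s : perm_on A s -> x \in A -> perm_on (A :\ x) (del x s).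
Proof.
move=> As xA; apply/subsetP=> u; rewrite inE => nu.
have ux : u != x by apply: contraNneq nu => ->; rewrite delx.
rewrite in_setD1 ux; apply: contraNT nu => uA.
by rewrite delE // (out_perm As uA) (negPf ux).
Qed.

Lemma del_perm_on A x s : s x \in A -> perm_on (A :\ x) (del x s) ->
  x \in A -> perm_on A s.
Proof.
move=> wA As xA; apply/subsetP=> u; rewrite inE => nu; apply: contraT => uA.
have ux : u != x by apply: contraNneq uA => ->.
have := out_perm As (x := u); rewrite in_setD1 (negPf uA) andbF delE // => /(_ isT).
case: eqP => [su eu|_ su]; last by rewrite su eqxx in nu.
by rewrite eu (negPf uA) in wA.
Qed.

(** Away from [x], erasure changes [s] only at the predecessor of [x]. If that predecessor lies in
    [B], so does [s x], and adding [x] restores stability; otherwise [B] was already stable. *)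
Lemma stable_undel x s B : x \notin B -> stable (del x s) B ->
  stable s B \/ stable s (x |: B).
Proof.
move=> xB /stableP Bs; have nx u : u \in B -> u != x.
  by move=> uB; apply: contraNneq xB => <-.
have [/exists_inP[p pB /eqP sp]|/exists_inP np] := boolP [exists p in B, s p == x].
- right; apply/stableP=> u; rewrite !in_setU1 => /orP[/eqP->|uB].
    by have := Bs p pB; rewrite delE ?nx // sp eqxx => ->; rewrite orbT.
  by have := Bs u uB; rewrite delE ?nx //; case: eqP => //= _ ->.
- left; apply/stableP=> u uB; have := Bs u uB; rewrite delE ?nx //.
  by case: eqP => // su; case: np; exists u => //; apply/eqP.
Qed.

Lemma stable_del x s B : s x != x -> B != set0 -> stable s B ->
  B :\ x != set0 /\ stable (del x s) (B :\ x).
Proof.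
move=> sx B0 /stableP Bs; split.
  apply: contraNneq sx => B1; have /set0Pn[u uB] := B0.
  have sub v : v \in B -> v = x.
    by move=> vB; apply/eqP; apply: contraT => vx; have := in_setD1 v B x;
       rewrite B1 vx vB inE.
  by apply/eqP/sub/Bs; rewrite -(sub u uB).
apply/stableP=> u; rewrite in_setD1 => /andP[ux uB].
rewrite delE // in_setD1; have [su|->] := eqVneq (s u) x; last exact: Bs.
by rewrite sx; apply: (Bs); rewrite -su; apply: (Bs).
Qed.

(** Minimality transfers because the nonempty stable subsets of [A] and of [A :\ x] turn into one
    another on removing [x] or, when necessary, putting it back. *)
Lemma cycle_on_del A x s : x \in A -> (1 < #|A|)%N ->
  cycle_on A s = (s x \in A :\ x) && cycle_on (A :\ x) (del x s).
Proof.
move=> xA A1; rewrite in_setD1; apply/cycle_onP/andP.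
  case=> A0 As minA; have sx : s x != x.
    apply: contraTneq A1 => sx; rewrite -(minA [set x]) ?cards1 //.
    - by apply/set0Pn; exists x; rewrite set11.
    - by rewrite sub1set.
    - by apply/stableP=> u /set1P->; rewrite sx set11.
  split; first by rewrite sx (perm_closed _ As).
  apply/cycle_onP; split; last 1 first.
  - move=> B B0 BA; have xB : x \notin B by apply/negP=> /(subsetP BA); rewrite !inE eqxx.
    have BA' : B \subset A by apply: subset_trans BA (subD1set _ _).
    case/stable_undel=> // Bs.
      by move: xB; rewrite (minA B) ?xA.
    rewrite -(minA (x |: B)) ?setU1K //.
      by apply/set0Pn; exists x; rewrite setU11.
    by rewrite subUset sub1set xA.
  - by rewrite -card_gt0; have := cardsD1 x A; rewrite xA; lia.
  - exact: perm_on_del.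
case=> /andP[sx wA] /cycle_onP[A0 As minA]; split.
- by apply/set0Pn; exists x.
- exact: del_perm_on As _.
move=> B B0 BA Bs; have [B0' Bs'] := stable_del sx B0 Bs.
have eqB := minA _ B0' (setSD _ BA) Bs'.
suff xB : x \in B by rewrite -(setD1K xB) eqB setD1K.
have AsA := del_perm_on wA As xA.
(* The predecessor of [x] lies in [A :\ x], that is in [B :\ x], so stability of [B] forces [x] into
   [B]. *)
have : s^-1 x \in A :\ x.
  by rewrite in_setD1 -(perm_closed _ AsA) permKV xA andbT (canF_eq (permKV s)) eq_sym.
by rewrite -eqB in_setD1 => /andP[_] /(stableP _ _ Bs); rewrite permKV.
Qed.

Lemma perm_on_tperm A x y : x \in A -> y \in A -> perm_on A (tperm x y).
Proof.
move=> xA yA; apply: subset_trans (tperm_on x y) _.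
by rewrite subUset !sub1set xA.
Qed.

Lemma perm_on_set1 x s : perm_on [set x] s -> s = 1.
Proof.
move=> xs; apply/permP=> u; rewrite perm1; have [/set1P->|] := boolP (u \in [set x]).
  by apply/set1P; rewrite (perm_closed _ xs) set11.
exact: out_perm.
Qed.

Lemma cycle_on1 C s : #|C| = 1%N -> cycle_on C s = (s == 1).
Proof.
move/eqP/cards1P=> [x ->]; apply/cycle_onP/eqP => [[_ /perm_on_set1]//|->].
split; first by apply/set0Pn; exists x; rewrite set11.
  exact: perm_on1.
move=> B B0 Bx _; apply/eqP; rewrite eqEcard Bx cards1.
by rewrite card_gt0.
Qed.

Lemma cycle_on_perm_on A s : cycle_on A s -> perm_on A s.
Proof. by case/cycle_onP. Qed.

(** Each erasure flips the parities of both the permutation and the cardinal, down to the identity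
    on one point. *)
Lemma odd_cycle_on A s : cycle_on A s -> odd_perm s = ~~ odd #|A|.
Proof.
have [k] := ubnP #|A|; elim: k A s => // k IHk A s Ak cA.
have [A1|A1] := leqP #|A| 1.
  have A1' : #|A| = 1%N.
    by apply/eqP; rewrite eqn_leq A1 card_gt0; case/cycle_onP: cA.
  by move: cA; rewrite cycle_on1 A1' // => /eqP->; rewrite odd_perm1.
have /set0Pn[x xA] : A != set0 by case/cycle_onP: cA.
move: cA; rewrite (cycle_on_del _ xA A1) => /andP[/setD1P[sx _] /IHk].
have -> : #|A| = #|A :\ x|.+1 by rewrite (cardsD1 x A) xA.
rewrite odd_del //= => <-; first by rewrite negbK.
by move: Ak; rewrite (cardsD1 x A) xA; lia.
Qed.

Lemma cycle_onJ s t : cycle_on setT (s ^ t) = cycle_on setT s.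
Proof.
suff sub a b : cycle_on setT a -> cycle_on setT (a ^ b).
  by apply/idP/idP=> [/(sub _ t^-1)|/sub//]; rewrite conjgK.
case/cycle_onP=> T0 _ minT; apply/cycle_onP; split=> //.
  by apply/subsetP=> u; rewrite inE.
move=> B B0 _ /stableP Bs; have /set0Pn[u uB] := B0.
have e : b @^-1: B = setT.
  apply: minT; rewrite ?subsetT //.
    by apply/set0Pn; exists (b^-1 u); rewrite inE permKV.
  by apply/stableP=> v; rewrite !inE => /Bs; rewrite permJ.
by apply/setP=> v; rewrite in_setT; have := in_setT (b^-1 v); rewrite -e inE permKV.
Qed.

(** * Factorizations into two cycles, and their behaviour under erasure *)

(* The number of ways to write s = b * c with b a cycle on C, c a cycle on A. *)
Definition num_fact_on A C s : nat :=
  \sum_(b : {perm T}) (cycle_on C b && cycle_on A (b^-1 * s)).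

(** As [b] fixes [x], the cycle [b^-1 * s] agrees with [s] at [x], and erasing [x] from it amounts
    to erasing [x] from [s]. *)
Lemma num_fact_on_del A C x s : x \in A -> (1 < #|A|)%N -> x \notin C ->
  perm_on A s ->
  num_fact_on A C s = ((s x != x) * num_fact_on (A :\ x) C (del x s))%N.
Proof.
move=> xA A1 xC As; rewrite /num_fact_on big_distrr /=; apply: eq_bigr => b _.
have [cb|//] := boolP (cycle_on C b); last by rewrite muln0.
have bx : b^-1 x = x.
  by apply: (canLR (permK b)); rewrite (out_perm (cycle_on_perm_on cb) xC).
rewrite (cycle_on_del _ xA A1) permM bx in_setD1 (perm_closed _ As) xA andbT mulnb.
by rewrite /del permM bx mulgA.
Qed.

(** Every cycle on [A] arises exactly once from a cycle on [A :\ x], by choosing the point [z] after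
    which [x] is inserted. *)
Lemma sum_cycle_on_insert (P : pred {perm T}) A x : x \in A -> (1 < #|A|)%N ->
  \sum_(b : {perm T}) (cycle_on A b && P b) =
  (\sum_(z in A :\ x) \sum_(b : {perm T}) (cycle_on (A :\ x) b && P (tperm x z * b)%g))%N.
Proof.
move=> xA A1.
transitivity (\sum_(z in A :\ x) \sum_(b : {perm T}) ((b z == x) && (cycle_on A b && P b)))%N.
  rewrite exchange_big; apply: eq_bigr => b _ /=.
  have [/andP[cb Pb]|_] := boolP (_ && _); last by rewrite big1 // => z _; rewrite andbF.
  have zA : b^-1 x \in A :\ x.
    rewrite in_setD1 -(perm_closed _ (cycle_on_perm_on cb)) permKV xA andbT.
    by move: cb; rewrite (cycle_on_del _ xA A1) in_setD1 (canF_eq (permKV b)) eq_sym => /andP[/andP[]].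
  rewrite (bigD1 _ zA) /= permKV eqxx big1 ?addn0 // => z /andP[_ zx].
  by rewrite andbT; case: (b z =P x) zx => // <-; rewrite permK eqxx.
apply: eq_bigr => z zA; rewrite (reindex_inj (mulgI (tperm x z))).
apply: eq_bigr => b _; rewrite andbA; congr (nat_of_bool (_ && _)).
have zx : z != x by case/setD1P: zA.
rewrite permM tpermR (cycle_on_del _ xA A1) permM tpermL.
have [bx|nx] /= := eqVneq (b x) x; last first.
  apply/esym/negbTE/negP=> /cycle_on_perm_on/(out_perm (x := x)).
  by rewrite !inE eqxx => /(_ isT) /eqP; rewrite (negPf nx).
have -> : del x (tperm x z * b) = b.
  apply/permP=> u; rewrite /del !permM tpermL.
  have [->|ux] := eqVneq u x; first by rewrite tpermL tpermR bx.
  have [->|uz] := eqVneq u z; first by rewrite tpermR bx tpermL.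
  rewrite [tperm x z u]tpermD 1?eq_sym // tpermD 1?eq_sym ?(inj_eq perm_inj) //.
  by rewrite -[X in _ != X]bx (inj_eq perm_inj).
have [cb|_] := boolP (cycle_on _ b); last by rewrite andbF.
by rewrite (perm_closed _ (cycle_on_perm_on cb)) zA.
Qed.

(* Here b ranges over cycles that move x; z is the predecessor of x in b. *)
Lemma num_fact_on_insert A x y s : x \in A -> y \in A -> x != y -> (2 < #|A|)%N ->
  perm_on A s ->
  num_fact_on A (A :\ y) s =
  (\sum_(z in A :\ x :\ y) (s z != x) *
     num_fact_on (A :\ x) (A :\ x :\ y) (del x (tperm x z * s)%g))%N.
Proof.
move=> xA yA xy A2 As; have cy : #|A :\ y|.+1 = #|A| by rewrite [RHS](cardsD1 y) yA.
rewrite {1}/num_fact_on (sum_cycle_on_insert (fun b => cycle_on A (b^-1 * s)) (x := x));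
  [|by rewrite in_setD1 xy|lia].
have -> : A :\ y :\ x = A :\ x :\ y by apply/setP=> u; rewrite !inE andbCA.
apply: eq_bigr => z /setD1P[_ /setD1P[_ zA]].
have sz : (tperm x z * s) x = s z by rewrite permM tpermL.
rewrite -sz -num_fact_on_del ?inE ?eqxx ?andbF //; [|lia|].
  by apply: eq_bigr => b _; rewrite invMg tpermV mulgA.
exact/perm_onM/As/perm_on_tperm.
Qed.

(** Indexing by the cycle on [A] allows two counts to be compared with that cycle held fixed. *)
Lemma num_fact_on_alt A C s :
  num_fact_on A C s = (\sum_(a : {perm T}) (cycle_on A a && cycle_on C (s * a^-1)%g))%N.
Proof.
rewrite /num_fact_on (reindex_inj (inj_comp (mulgI s) (@invg_inj _))) /=.
by apply: eq_bigr => a _; rewrite invMg invgK mulgKV andbC.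
Qed.

(* Here b fixes x. Erasing x from the cycle c = b^-1 * s leaves a cycle c' with
   del x s = b * c'; erasing moreover z = c'^-1 (s x) from b, one gets a
   factorization, with the same c', of del x (tperm x z * s). *)
Lemma num_fact_on_shift A x s : x \in A -> perm_on A s -> s x != x -> (2 < #|A|)%N ->
  num_fact_on A (A :\ x) s =
  (\sum_(z in A :\ x) (s z != x) *
     num_fact_on (A :\ x) (A :\ x :\ z) (del x (tperm x z * s)%g))%N.
Proof.
move=> xA As sx A2; have cx : #|A :\ x|.+1 = #|A| by rewrite [RHS](cardsD1 x) xA.
rewrite (@num_fact_on_del A _ x) ?inE ?eqxx //; last lia.
rewrite sx mul1n num_fact_on_alt.
under [RHS]eq_bigr => z _ do rewrite num_fact_on_alt big_distrr.
rewrite exchange_big /=; apply: eq_bigr => a _.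
have [ca|_] /= := boolP (cycle_on _ a); last by rewrite big1 // => z _; rewrite muln0.
set w := s x; have wA : w \in A :\ x by rewrite in_setD1 sx (perm_closed _ As).
set z0 := a^-1 w.
have az0 : a z0 = w by rewrite permKV.
have zA : z0 \in A :\ x by rewrite -(perm_closed _ (cycle_on_perm_on ca)) az0.
have rz z : z \in A :\ x -> del x (tperm x z * s) z = w.
  case/setD1P=> zx _; rewrite delE // !permM tpermR tpermL -/w.
  by rewrite (negPf sx).
(* Only [z0] contributes: the short cycle has to fix [z], but it sends [z] to [a^-1 w = z0]. *)
rewrite (bigD1 _ zA) /= big1 ?addn0; last first.
  move=> z /andP[zA' zz0]; apply/eqP; rewrite muln_eq0; apply/orP; right.
  rewrite eqb0; apply: contra zz0 => /cycle_on_perm_on/(out_perm (x := z)).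
  by rewrite !inE eqxx permM rz // => /(_ isT) <-.
have z0x : z0 != x by case/setD1P: zA.
rewrite mulnb (cycle_on_del (x := z0)) //; last lia.
congr nat_of_bool.
have e1 : ((del x s * a^-1) z0 != z0) = (s z0 != x).
  rewrite permM (canF_eq (permKV a)) az0 delE //.
  by have [_|_] := eqVneq (s z0) x; rewrite ?eqxx // /w (inj_eq perm_inj) z0x.
have uA : (del x s * a^-1) z0 \in A :\ x.
  rewrite permM -(perm_closed _ (cycle_on_perm_on ca)) permKV.
  by rewrite (perm_closed _ (perm_on_del As xA)).
rewrite in_setD1 uA e1 andbT; case: eqP => //= /eqP sz0; congr cycle_on.
have uz : (del x s * a^-1) z0 = a^-1 (s z0) by rewrite permM delE // (negPf sz0).
(* Both sides become [s] times two transpositions times [a^-1]; transpositions are moved across by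
   conjugation, using [a z0 = w] and [s x = w]. *)
have -> : del z0 (del x s * a^-1) = del x s * tperm w (s z0) * a^-1.
  by rewrite [del z0 _]/del uz -!mulgA [tperm w _ * _]conjgC tpermJ.
congr (_ * _); rewrite /del permM tpermL [tperm x z0 * s]conjgC tpermJ -/w.
rewrite -!mulgA; congr (_ * _); rewrite [LHS]conjgC tpermJ tpermL tpermD //.
Qed.

(** * Parity, and the count for a single fixed point of the short cycle *)

(** Cycles on sets whose sizes differ by one have opposite parities, so their product is odd. *)
Lemma num_fact_on_eq0 A C s : #|A| = #|C|.+1 -> ~~ odd_perm s -> num_fact_on A C s = 0%N.
Proof.
move=> AC es; rewrite /num_fact_on big1 // => b _.
have [/andP[/odd_cycle_on ob /odd_cycle_on]|//] := boolP (_ && _).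
by rewrite odd_permM odd_permV ob AC (negPf es) addbF /=; case: odd.
Qed.

Lemma odd_perm_moves s : odd_perm s -> exists x, s x != x.
Proof.
move=> os; apply/existsP; apply: contraLR os; rewrite negb_exists => /forallP s1.
suff -> : s = 1 by rewrite odd_perm1.
by apply/permP=> u; rewrite perm1; apply/eqP; rewrite -[_ == _]negbK.
Qed.

(* By num_fact_on_insert and num_fact_on_shift, the left-hand side for s on A
   is the sum, over the |A| - 2 points z other than x and s^-1 x, of the
   left-hand sides for del x (tperm x z * s) on A :\ x. *)
Lemma sum_num_fact_on k A s : #|A| = k.+2 -> perm_on A s -> odd_perm s ->
  (\sum_(y in A) num_fact_on A (A :\ y) s = 2 * k`!)%N.
Proof.
elim: k A s => [|k IHk] A s cA As os; have [x sx] := odd_perm_moves os.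
  (* Base case: [s] swaps the two points of [A], and for either [y] the only possible [b] is the
     identity. *)
  have xA : x \in A by apply: contraNT sx => /(out_perm As)/eqP.
  have cA1 y : y \in A -> #|A :\ y| = 1%N.
    by move=> yA; have := cardsD1 y A; rewrite yA cA; lia.
  have cs : cycle_on A s.
    rewrite (cycle_on_del _ xA) ?cA // in_setD1 sx (perm_closed _ As) xA /=.
    rewrite cycle_on1 ?cA1 //; have /eqP/cards1P[z Az] := cA1 x xA.
    by apply/eqP/(@perm_on_set1 z); rewrite -Az; apply: perm_on_del.
  rewrite (eq_bigr (fun=> 1%N)) ?sum1_card ?cA // => y yA.
  rewrite /num_fact_on (bigD1 1) //= invg1 mul1g cs cycle_on1 ?cA1 // eqxx.
  by rewrite big1 // => b /negPf b1; rewrite cycle_on1 ?cA1 // b1.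
have xA : x \in A by apply: contraNT sx => /(out_perm As)/eqP.
have A2 : (2 < #|A|)%N by rewrite cA.
have cAx : #|A :\ x| = k.+2 by have := cardsD1 x A; rewrite xA cA; lia.
set rho := fun z => del x (tperm x z * s).
transitivity (\sum_(z in A :\ x) (s z != x) *
   \sum_(y in A :\ x) num_fact_on (A :\ x) (A :\ x :\ y) (rho z))%N.
  (* The term [y = x] on the left, once shifted, supplies the diagonal [z = y]; insertion in the
     other terms supplies [z != y]. *)
  under [RHS]eq_bigr do rewrite big_distrr.
  rewrite [RHS]exchange_big /= (bigD1 x) //= num_fact_on_shift //.
  rewrite [X in (_ + X)%N](eq_bigl (fun y => y \in A :\ x)) => [|y]; last by rewrite !inE andbC.
  rewrite -big_split; apply: eq_bigr => y yA; have [yx yA'] := setD1P yA.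
  rewrite (@num_fact_on_insert A x y) //; last by rewrite eq_sym.
  rewrite [RHS](bigD1 y) //=; congr (_ + _)%N.
  by apply: eq_bigl => z; rewrite !inE andbC.
have rhoE z : z \in A :\ x -> s z != x ->
    (\sum_(y in A :\ x) num_fact_on (A :\ x) (A :\ x :\ y) (rho z) = 2 * k`!)%N.
  case/setD1P=> zx zA sz; apply: IHk => //.
    exact/perm_on_del/xA/perm_onM/As/perm_on_tperm.
  (* The transposition and the erasure each flip the parity, so [rho z] stays odd. *)
  by rewrite odd_del ?permM ?tpermL // odd_permM odd_tperm eq_sym zx os.
have pA : s^-1 x \in A :\ x.
  rewrite in_setD1 -(perm_closed _ As) permKV xA andbT.
  by rewrite (canF_eq (permKV s)) eq_sym.
rewrite (bigD1 (s^-1 x)) //= permKV eqxx add0n.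
rewrite (eq_bigr (fun=> (2 * k`!)%N)) => [|z /andP[zA zp]]; last first.
  have sz : s z != x by rewrite (canF_eq (permK s)).
  by rewrite sz mul1n rhoE.
rewrite (eq_bigl (fun z => z \in A :\ x :\ s^-1 x)) => [|z]; last by rewrite !inE andbC.
rewrite sum_nat_const factS mulnCA; congr (_ * (_ * _))%N.
by have := cardsD1 (s^-1 x) (A :\ x); rewrite pA cAx => -[].
Qed.


(** * Sets containing no cycle, and the erasure of all their points *)

(** Nonempty stable sets are unions of cycles, so this forbids whole cycles of [s] inside [S], fixed
    points included. *)
Definition cycle_free S s :=
  [forall B : {set T}, (B != set0) && (B \subset S) ==> ~~ stable s B].

Lemma cycle_freeP S s :
  reflect (forall B : {set T}, B != set0 -> B \subset S -> ~~ stable s B)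
    (cycle_free S s).
Proof.
apply: (iffP forallP) => noS B; first by move=> B0 BS; apply: implyP (noS B) _; rewrite B0.
by apply/implyP=> /andP[]; apply: noS.
Qed.

Lemma cycle_free_del S x s : x \in S ->
  cycle_free S s = (s x != x) && cycle_free (S :\ x) (del x s).
Proof.
move=> xS; apply/cycle_freeP/andP=> [noS|[sx /cycle_freeP noS] B B0 BS].
  split.
    apply: contraTneq (noS [set x] _ _) => [sx||]; rewrite ?sub1set //.
      by rewrite negbK; apply/stableP=> u /set1P->; rewrite sx set11.
    by apply/set0Pn; exists x; rewrite set11.
  apply/cycle_freeP=> B B0 BS.
  have xB : x \notin B by apply/negP=> /(subsetP BS); rewrite !inE eqxx.
  have BS' : B \subset S by apply: subset_trans BS (subD1set _ _).
  apply/negP=> /(stable_undel xB)[]; apply/negP/noS => //.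
    by apply/set0Pn; exists x; rewrite setU11.
  by rewrite subUset sub1set xS.
apply/negP=> /(stable_del sx B0)[B0']; apply/negP/noS => //.
exact: setSD.
Qed.

(** The points of [S] are fixed by [b], hence can be erased one at a time. Each erasure flips the
    parities of [s] and of [#|S|]; a point of [S] fixed by the current permutation makes both sides
    vanish. *)
Lemma sum_num_fact_onD k A S s : S \subset A -> #|A| = (#|S| + k.+2)%N ->
  perm_on A s ->
  (\sum_(y in A :\: S) num_fact_on A (A :\: S :\ y) s =
   (odd_perm s != odd #|S|) && cycle_free S s * (2 * k`!))%N.
Proof.
have [m Sm] : exists m, #|S| = m by exists #|S|.
elim: m A S s Sm => [|m IHm] A S s Sm SA cA As.
  have S0 : S = set0 by apply: cards0_eq.
  have -> : cycle_free S s.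
    by apply/cycle_freeP=> B B0; rewrite S0 subset0 (negPf B0).
  move: cA; rewrite Sm S0 setD0 andbT => cA.
  have [os|es] := boolP (odd_perm s); first by rewrite (@sum_num_fact_on k) ?mul1n.
  rewrite big1 // => y yA; apply: num_fact_on_eq0 => //.
  by rewrite [LHS](cardsD1 y) yA.
have /set0Pn[x xS] : S != set0 by rewrite -card_gt0 Sm.
have xA := subsetP SA x xS.
have cSx : #|S :\ x| = m by have := cardsD1 x S; rewrite xS Sm => -[].
have cAx : #|A :\ x| = (#|S :\ x| + k.+2)%N.
  by have := cardsD1 x A; rewrite xA cA Sm cSx; lia.
rewrite (cycle_free_del _ xS).
transitivity
  ((s x != x) * \sum_(y in A :\: S) num_fact_on (A :\ x) (A :\: S :\ y) (del x s))%N.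
  rewrite big_distrr; apply: eq_bigr => y _; apply: num_fact_on_del => //.
    by rewrite cA Sm; lia.
  by rewrite !inE xS andbF.
have [|sx] := eqVneq (s x) x; first by rewrite andbF.
have eqAS : A :\: S = (A :\ x) :\: (S :\ x).
  by apply/setP=> u; rewrite !inE; have [->|] := eqVneq u x; rewrite ?xS.
rewrite mul1n eqAS IHm //; [|exact: setSD|exact: perm_on_del].
by rewrite odd_del // cSx Sm /=; case: odd_perm; case: odd.
Qed.

(** * Orbits, supports and marked points *)

Lemma cycle_on_porbit A s x : cycle_on A s -> x \in A -> porbit s x = A.
Proof.
case/cycle_onP=> _ As minA xA; apply: minA.
- by apply/set0Pn; exists x; apply: porbit_id.
- apply/subsetP=> _ /porbitP[i ->]; elim: i => [|i]; first by rewrite perm1.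
  by rewrite expgSr permM (perm_closed _ As).
- by apply/stableP=> _ /porbitP[i ->]; rewrite -permM -expgSr mem_porbit.
Qed.

Lemma stable_porbit s B x : stable s B -> x \in B -> porbit s x \subset B.
Proof.
move=> /stableP Bs xB; apply/subsetP=> _ /porbitP[i ->].
by elim: i => [|i]; [rewrite perm1 | rewrite expgSr permM => /Bs].
Qed.

Lemma card_porbit1 s x : (#|porbit s x| == 1%N) = (s x == x).
Proof.
apply/idP/eqP=> [/cards1P[y sxy]|sx].
  have := porbit_id s x; have := mem_porbit s 1 x.
  by rewrite expg1 sxy => /set1P-> /set1P->.
apply/cards1P; exists x; apply/setP=> y; rewrite inE.
apply/porbitP/eqP => [[i ->]|->]; last by exists 0; rewrite perm1.
by elim: i => [|i IHi]; rewrite ?perm1 // expgSr permM IHi.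
Qed.

Lemma cycle_on_support A s : cycle_on A s -> (1 < #|A|)%N ->
  A = [set x | s x != x].
Proof.
move=> cA A1; apply/setP=> x; rewrite inE; apply/idP/idP=> [xA|].
  by move: cA; rewrite (cycle_on_del _ xA A1) in_setD1 -andbA => /andP[].
by apply: contraNT => /(out_perm (cycle_on_perm_on cA))/eqP.
Qed.

(** Double counting of the pairs [(F, y)] with [y] in [F]. It serves to mark one point [y] of the
    complement [F] of the short cycle. *)
Lemma sum_setU1 (g : {set T} -> nat) m :
  (m.+1 * (\sum_(F : {set T} | #|F| == m.+1) g F) =
   \sum_(S : {set T} | #|S| == m) \sum_(y in ~: S) g (y |: S))%N.
Proof.
rewrite (exchange_big_dep predT) //= big_distrr /=.
transitivity (\sum_(F : {set T} | #|F| == m.+1) \sum_(y in F) g F)%N.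
  by apply: eq_bigr => F /eqP cF; rewrite sum_nat_const cF.
rewrite (exchange_big_dep predT) //=; apply: eq_bigr => y _.
rewrite (reindex_onto (fun S => y |: S) (fun F => F :\ y)) /=; last first.
  by move=> F /andP[_ yF]; rewrite setD1K.
apply: eq_bigl => S; rewrite setU11 andbT cardsU1 inE.
have [yS|yS] /= := boolP (y \in S); last by rewrite setU1K // eqxx !andbT eqSS.
rewrite andbF; apply/negP=> /andP[_ /eqP/setP/(_ y)].
by rewrite !inE eqxx yS.
Qed.

End CycleOn.

(** * From cycle types to cycles on sets *)

Lemma is_kcycleP n k (s : 'S_n) : (0 < k)%N ->
  reflect (exists2 A : {set 'I_n}, #|A| = k & cycle_on A s) (is_kcycle k s).
Proof.
move=> k0; apply: (iffP eqP) => [sk|[A cA As]].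
  set sz := fun C : {set 'I_n} => #|C|.
  have pk : perm_eq (map sz (enum (porbits s))) (k :: nseq (n - k) 1%N).
    by rewrite -sk perm_sym; apply/permPl/perm_sort.
  have : k \in map sz (enum (porbits s)) by rewrite (perm_mem pk) mem_head.
  case/mapP=> A; rewrite mem_enum => As kA; exists A => //.
  (* Cancelling the part [k] contributed by [A] leaves only parts 1, so every other orbit is a
     singleton. *)
  have s1 u : u \notin A -> s u = u.
    move=> uA; apply/eqP; rewrite -card_porbit1.
    have pA : perm_eq (enum (porbits s)) (A :: rem A (enum (porbits s))).
      by rewrite perm_to_rem // mem_enum.
    have ur : porbit s u \in rem A (enum (porbits s)).
      have : porbit s u \in enum (porbits s) by rewrite mem_enum imset_f.
      rewrite (perm_mem pA) inE; case/orP=> // /eqP e.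
      by rewrite -e porbit_id in uA.
    have : perm_eq (map sz (rem A (enum (porbits s)))) (nseq (n - k) 1%N).
      rewrite -(perm_cons k) -(permPr pk) perm_sym.
      by rewrite {1}kA -[_ :: _]/(map sz (A :: _)); apply: perm_map.
    by move/perm_mem/(_ #|porbit s u|); rewrite map_f // mem_nseq => /esym/andP[].
  case/imsetP: As => x _ Ax; apply/cycle_onP; split.
  - by apply/set0Pn; exists x; rewrite Ax porbit_id.
  - by apply/subsetP=> u; rewrite inE; apply: contraNT => /s1 ->.
  - move=> B /set0Pn[u uB] BA Bs; apply/eqP; rewrite eqEsubset BA.
    have := subsetP BA u uB; rewrite Ax -eq_porbit_mem => /eqP <-.
    by rewrite stable_porbit.
have [A0 sA _] := cycle_onP _ _ As.
have /set0Pn[x xA] := A0.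
have Ao : A \in porbits s by rewrite -(cycle_on_porbit As xA) imset_f.
have su1 u : u \notin A -> porbit s u = [set u].
  move/(out_perm sA)/eqP; rewrite -card_porbit1 => /eqP su.
  by apply/eqP; rewrite eq_sym eqEcard sub1set porbit_id cards1 su.
have sE : porbits s = A |: [set [set u] | u in ~: A].
  apply/setP=> C; apply/imsetP/setU1P.
    case=> u _ ->; have [uA|uA] := boolP (u \in A).
      by left; apply: cycle_on_porbit.
    by right; apply/imsetP; exists u; rewrite ?inE ?su1.
  case=> [->|/imsetP[u]]; first by exists x => //; rewrite (cycle_on_porbit As).
  by rewrite inE => uA ->; exists u; rewrite ?su1.
have pE : perm_eq [seq #|(C : {set 'I_n})| | C <- enum (porbits s)] (k :: nseq (n - k) 1%N).
  have pA : perm_eq (enum (porbits s)) (A :: enum (porbits s :\ A)).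
    apply: uniq_perm; rewrite /= ?enum_uniq ?mem_enum ?inE ?eqxx //.
    by move=> C; rewrite inE !mem_enum !inE; case: eqP => // ->.
  apply: (perm_trans (perm_map _ pA)); rewrite /= cA perm_cons.
  have -> : porbits s :\ A = [set [set u] | u in ~: A].
    rewrite sE setU1K //; apply/imsetP=> -[u]; rewrite inE => /negP uA eA.
    by apply: uA; rewrite eA set11.
  set r := map _ _; have /all_pred1P -> : all (pred1 1%N) r.
    by apply/allP=> l /mapP[C]; rewrite mem_enum => /imsetP[u _ ->] ->; rewrite /= cards1.
  rewrite size_map -cardE card_imset; last exact: set1_inj.
  by rewrite cardsCs setCK cA card_ord.
have geq_tr : transitive geq by move=> a b c ba ac; apply: leq_trans ac ba.
(* Two lists sorted for [geq] with the same parts are equal; [0 < k] is what puts [k] in front of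
   the ones. *)
apply: (@sorted_eq _ geq) => //.
- by move=> a b /andP[/= ba ab]; apply/eqP; rewrite eqn_leq ab ba.
- by apply: sort_sorted => a b; apply: leq_total.
- rewrite /= (path_sortedE geq_tr) all_nseq /= k0 orbT /=.
  by elim: (n - k)%N => // m IHm; rewrite /= path_min_sorted ?all_nseq ?orbT.
- by rewrite perm_sort.
Qed.

(** * Counting factorizations in the symmetric group *)

Lemma is_kcycle_full n (s : 'S_n) : (0 < n)%N -> is_kcycle n s = cycle_on setT s.
Proof.
move=> n0; apply/(is_kcycleP s n0)/idP=> [[A cA]|cs]; last first.
  by exists setT; rewrite // cardsT card_ord.
suff -> : A = setT by [].
by apply/eqP; rewrite eqEcard subsetT cardsT card_ord cA leqnn.
Qed.

(* When n - a = 1, the identity is a cycle on each singleton, so it would be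
   counted n times on the right; the second hypothesis makes both sides 0. *)
Lemma num_factorizationsE n a (s : 'S_n) : (a < n)%N ->
  ~ ((n - a)%N = 1%N /\ is_kcycle n s) ->
  (num_factorizations a s =
   \sum_(F : {set 'I_n} | #|F| == a) num_fact_on setT (~: F) s)%N.
Proof.
move=> an hdeg; have n0 : (0 < n)%N by apply: leq_ltn_trans an.
have m0 : (0 < n - a)%N by rewrite subn_gt0.
rewrite /num_factorizations -sum1dep_card.
rewrite -(pair_big_dep xpredT (fun t u => [&& is_kcycle n t, is_kcycle (n - a) u & s == t * u])
  (fun _ _ => 1%N)) /=.
rewrite (exchange_big_dep xpredT) //= [RHS]exchange_big /=.
apply: eq_bigr => b _.
transitivity (nat_of_bool (is_kcycle (n - a) b && cycle_on setT (b^-1 * s))).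
  (* Conjugation by [b] exchanges the two orders of the factors. *)
  have -> : cycle_on setT (b^-1 * s) = is_kcycle n (s * b^-1).
    by rewrite is_kcycle_full // -(cycle_onJ (s * b^-1) b) conjgE mulgKV.
  have [/andP[cb cs]|ncs] := boolP (_ && _).
    rewrite (big_pred1 (s * b^-1)) // => t /=; rewrite cb /=.
    by apply/andP/eqP=> [[_ /eqP->]|->]; rewrite ?mulgK ?mulgKV.
  rewrite big_pred0 // => t; apply: contraNF ncs => /and3P[ct cb /eqP->].
  by rewrite cb mulgK.
have cT (F : {set 'I_n}) : #|~: F| = (n - #|F|)%N by rewrite cardsCs setCK card_ord.
have [cs|ncs] := boolP (cycle_on setT (b^-1 * s)); last first.
  by rewrite andbF big1 // => F _; rewrite andbF.
rewrite andbT; under eq_bigr do rewrite andbT.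
have noid : (n - a)%N = 1%N -> b != 1.
  move=> na; apply/eqP=> b1; apply: hdeg; split=> //.
  by rewrite is_kcycle_full // -[s]mul1g -invg1 -b1.
have [m1|m1] := leqP (n - a) 1.
  have na : (n - a)%N = 1%N by apply/eqP; rewrite eqn_leq m1.
  rewrite big1 => [|F /eqP cF]; last first.
    by rewrite cycle_on1 ?cT ?cF // (negPf (noid na)).
  apply/eqP; rewrite eqb0; apply/(is_kcycleP b m0) => -[A cA].
  by rewrite cycle_on1 ?cA // (negPf (noid na)).
have [/(is_kcycleP b m0)[A cA cb]|nb] := boolP (is_kcycle _ b); last first.
  rewrite big1 // => F /eqP cF; apply/eqP; rewrite eqb0.
  by apply: contra nb => cb; apply/is_kcycleP => //; exists (~: F); rewrite // cT cF.
(* Here the cycle has at least two points, so its support determines [A] and a single [F]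
   contributes. *)
rewrite (bigD1 (~: A)) /= ?cT ?cA ?subKn ?setCK ?cb // 1?ltnW //.
rewrite big1 // => F /andP[/eqP cF FA]; apply/eqP; rewrite eqb0.
apply: contra FA => cb'; rewrite -[F]setCK.
have -> := cycle_on_support cb'; last by rewrite cT cF.
by have <- := cycle_on_support cb; last by rewrite cA.
Qed.

Lemma mul_num_factorizations n a (s : 'S_n) : (2 <= a)%N -> (a < n)%N ->
  (forall l : nat, l \in cycle_type s -> (l < a)%N -> l = 1%N) ->
  ~ ((n - a)%N = 1%N /\ is_kcycle n s) ->
  (a * num_factorizations a s =
   (odd_perm s == odd a) * 'C(n - num_fixed s, a.-1) * (2 * (n - a - 1)`!))%N.
Proof.
move=> a2 an hs hdeg; rewrite num_factorizationsE //.
case: a a2 an hs {hdeg} => // m m1 mn hs; rewrite sum_setU1 /=.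
set k := (n - m.+1 - 1)%N; have nk : n = (m + k.+2)%N by rewrite /k; lia.
(* A cycle inside [S] has length at most [m = a - 1], hence is a fixed point by [hs]. *)
have noS (S : {set 'I_n}) : #|S| = m ->
    cycle_free S s = (S \subset ~: [set x | s x == x]).
  move=> cS; apply/cycle_freeP/subsetP=> [noS u uS|noS B /set0Pn[u uB] BS].
    rewrite !inE; apply: contra (noS [set u] _ _) => [/eqP su||].
    - by apply/stableP=> _ /set1P->; rewrite su set11.
    - by apply/set0Pn; exists u; rewrite set11.
    - by rewrite sub1set.
  have := noS u (subsetP BS u uB); rewrite !inE; apply: contra => Bs.
  rewrite -card_porbit1; apply/eqP/hs.
    rewrite mem_sort; apply: map_f.
    by rewrite mem_enum imset_f.
  by rewrite ltnS -cS subset_leq_card // (subset_trans (stable_porbit Bs uB)).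
transitivity (\sum_(S : {set 'I_n} | (S \subset ~: [set x | s x == x]) && (#|S| == m))
   (odd_perm s == ~~ odd m) * (2 * k`!))%N.
  rewrite big_mkcondl /=; apply: eq_bigr => S /eqP cS.
  rewrite -noS //; transitivity (\sum_(y in setT :\: S) num_fact_on setT (setT :\: S :\ y) s)%N.
    rewrite setTD; apply: eq_bigr => y _; congr num_fact_on.
    by apply/setP=> u; rewrite !inE negb_or.
  rewrite (@sum_num_fact_onD _ k) ?subsetT ?cardsT ?card_ord ?cS //; last first.
    by apply/subsetP=> u; rewrite inE.
  by case: cycle_free; rewrite ?andbF ?andbT //; case: odd_perm; case: odd.
rewrite sum_nat_const mulnCA mulnA; congr (_ * _ * _)%N.
have -> : (n - num_fixed s)%N = #|~: [set x | s x == x]|.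
  by rewrite cardsCs setCK card_ord.
rewrite -cards_draws.
by apply: eq_card => S; rewrite !inE.
Qed.

(** * The closed formula over the rationals *)

Import GRing.Theory Num.Theory.
Local Open Scope ring_scope.

Theorem proposition1p3 (n a : nat) (sigma : 'S_n) (ha : (2 <= a)%N)
  (han : (a < n)%N)
  (hsigma : forall l : nat, l \in cycle_type sigma -> (l < a)%N -> l = 1%N)
  (hdeg : ~ ((n - a)%N = 1%N /\ is_kcycle n sigma)) :
  (num_factorizations a sigma)%:R =
    (1 + (-1) ^+ a * signature sigma)
    * ((n - a - 1)`!%:R * (n - num_fixed sigma)`!%:R / a`!%:R
       * recip_fact (n%:Z - a%:Z - (num_fixed sigma)%:Z + 1)) :> rat.
Proof.
have a0 : a%:R != 0 :> rat by rewrite pnatr_eq0; lia.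
have fact0 m : m`!%:R != 0 :> rat by rewrite pnatr_eq0 -lt0n fact_gt0.
apply: (mulfI a0); rewrite -[LHS]natrM mul_num_factorizations // !natrM.
have -> : 1 + (-1) ^+ a * signature sigma = 2 * (odd_perm sigma == odd a)%:R :> rat.
  rewrite /signature -signr_odd; case: (odd a); case: odd_perm;
    by rewrite /= ?expr0 ?expr1; ring.
have bn : (num_fixed sigma <= n)%N by apply: leq_trans (max_card _) _; rewrite card_ord.
set b := num_fixed sigma in bn *.
(* The argument of [recip_fact] is [(n - b) - (a - 1)]; it is negative exactly when the binomial
   coefficient vanishes, which matches the zero convention. *)
have bE : 'C(n - b, a.-1)%:R =
    (n - b)`!%:R / (a.-1)`!%:R * recip_fact (n%:Z - a%:Z - b%:Z + 1) :> rat.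
  have [le_a|lt_a] := leqP a.-1 (n - b).
    have -> : n%:Z - a%:Z - b%:Z + 1 = Posz (n - b - a.-1) by lia.
    rewrite /= -(bin_fact le_a) !natrM; field.
    by rewrite !fact0.
  rewrite bin_small //; case e : (n%:Z - a%:Z - b%:Z + 1) => [m|m] /=; last by rewrite mulr0.
  by lia.
rewrite bE -[in RHS](prednK (ltnW ha)) factS natrM prednK 1?ltnW //.
by field; rewrite a0 fact0.
Qed.
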